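(* Let $G=(V,E,m,\mu)$ be a weighted graph, let $\rho$ be an intrinsic metric on $G$, and let $o\in V$. Suppose that for each $r>0$ the ball $B_r(o)=\{x\in V\mid\rho(x,o)\le r\}$ is a finite set. Then $G$ is a complete graph.
   Context: Weighted graphs: $(V,E)$ is a (finite or infinite) undirected, connected, locally finite graph (every vertex has finitely many neighbors; self-loops are allowed); $x\sim y$ means $(x,y)\in E$. $\mu:E\to(0,\infty)$, $(x,y)\mapsto\mu_{xy}$, is symmetric and extended by $\mu_{xy}=0$ if $x\not\sim y$; $m:V\to(0,\infty)$ is a measure on $V$. The quadruple $G=(V,E,m,\mu)$ is called a weighted graph. $C_0(V)$ is the set of finitely supported functions $V\to\mathbb{R}$. A pseudo metric is a symmetric function $\rho:V\times V\to[0,\infty)$ with zero diagonal satisfying the triangle inequality. A pseudo metric $\rho$ on $V$ is called an intrinsic metric if $\sum_{y\in V}\mu_{xy}\rho^2(x,y)\le m(x)$ for all $x\in V$. $\Gamma(f)(x)=\frac{1}{2m(x)}\sum_y\mu_{xy}(f(y)-f(x))^2$ for $f:V\to\mathbb{R}$. Complete graph: there is a nondecreasing sequence $\{\eta_k\}_{k=1}^\infty\subset C_0(V)$ with $\lim_{k\to\infty}\eta_k=\mathds{1}$ pointwise ($\mathds{1}$ the constant function $1$) and $\Gamma(\eta_k)\le\frac1k$ on $V$ for every $k$. *)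

(* Defs.v *)
From HB Require Import structures.
From mathcomp Require Import all_boot all_order all_algebra.
From mathcomp Require Import all_classical all_reals all_analysis.

Set Implicit Arguments.
Unset Strict Implicit.
Unset Printing Implicit Defensive.

Import Order.TTheory GRing.Theory Num.Theory.
Import numFieldNormedType.Exports.

Local Open Scope classical_set_scope.
Local Open Scope ring_scope.

(* [mu] is total on [V * V], carrying the convention that it vanishes off the
   edges. Self-loops are allowed. *)
Record weighted_graph (R : realType) (V : choiceType) := WeightedGraph {
  edge : rel V;
  mu : V -> V -> R;
  m : V -> R;
  edge_sym : forall x y, edge x y = edge y x;
  edge_connected : forall x y, exists2 p, path edge x p & last x p = y;
  edge_locally_finite : forall x, finite_set [set y | edge x y];
  mu_gt0 : forall x y, edge x y -> 0 < mu x y;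
  mu_eq0 : forall x y, ~~ edge x y -> mu x y = 0;
  mu_sym : forall x y, mu x y = mu y x;
  m_gt0 : forall x, 0 < m x
}.

Definition finitely_supported (R : realType) (V : choiceType) (f : V -> R) :=
  finite_set [set x | f x != 0].

Definition pseudo_metric (R : realType) (V : choiceType)
    (rho : V -> V -> R) : Prop :=
  [/\ forall x y, 0 <= rho x y,
      forall x y, rho x y = rho y x,
      forall x, rho x x = 0 &
      forall x y z, rho x z <= rho x y + rho y z].

(* The sums over all of [V] below are honest: by local finiteness, only
   finitely many of their terms are nonzero. *)
Definition intrinsic_metric (R : realType) (V : choiceType)
    (G : weighted_graph R V) (rho : V -> V -> R) : Prop :=
  pseudo_metric rho /\
  forall x, \sum_(y \in [set: V]) mu G x y * rho x y ^+ 2 <= m G x.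

Definition Gamma (R : realType) (V : choiceType) (G : weighted_graph R V)
    (f : V -> R) (x : V) : R :=
  (2 * m G x)^-1 * \sum_(y \in [set: V]) mu G x y * (f y - f x) ^+ 2.

(* The sequence is indexed from 0: [eta k] stands for $\eta_{k+1}$. *)
Definition complete_graph (R : realType) (V : choiceType)
    (G : weighted_graph R V) : Prop :=
  exists eta : nat -> V -> R,
    [/\ forall k, finitely_supported (eta k),
        forall x, nondecreasing_seq (fun k => eta k x),
        forall x, eta k x @[k --> \oo] --> (1 : R) &
        forall k x, Gamma G (eta k) x <= k.+1%:R^-1].

(* Main.v *)
Require Import Defs.
From mathcomp Require Import all_boot all_order all_algebra.
From mathcomp Require Import all_classical all_reals all_analysis.
From mathcomp Require Import finmap lra.
Import Order.TTheory GRing.Theory Num.Theory.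
Import numFieldNormedType.Exports.
Local Open Scope classical_set_scope.
Local Open Scope ring_scope.

(** The cutoffs [eta_n x = min(1, max(0, 2 - rho(x, o) / n))] are [1/n]-Lipschitz
    for [rho], so the intrinsic condition gives [Gamma eta_n <= 1/(2 n^2)]. They
    are supported in balls of radius [2n], and equal 1 on balls of radius [n]. *)

Definition clamp {R : realType} (t : R) : R := Num.max 0 (Num.min 1 t).

Lemma clamp_lipschitz (R : realType) (s t : R) :
  `|clamp s - clamp t| <= `|s - t|.
Proof.
(* Once [s] and [t] are placed relative to 0 and 1, [clamp] is affine, and the norm enters only as
   an upper bound of [s - t] and [t - s]. *)
rewrite /clamp ler_norml; have := ler_norm (s - t).
have := ler_norm (t - s); rewrite (distrC t).
case: (leP 1 s) => ?; case: (leP 1 t) => ?; rewrite ?(max_r ler01);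
  try case: (leP 0 s) => ?; try case: (leP 0 t) => ?; lra.
Qed.

Lemma clamp_homo (R : realType) : {homo (@clamp R) : s t / s <= t}.
Proof. by move=> s t st; apply: le_max2 => //; apply: le_min2. Qed.

Lemma clamp_eq1 (R : realType) (t : R) : 1 <= t -> clamp t = 1.
Proof. by move=> t1; rewrite /clamp min_l// max_r. Qed.

Lemma clamp_eq0 (R : realType) (t : R) : t <= 0 -> clamp t = 0.
Proof. by move=> t0; rewrite /clamp max_l// ge_min t0 orbT. Qed.

(** The weight [mu G x y] vanishes off the finitely many neighbours of [x]; a sum over a list can
    then be compared term by term. *)
Lemma fsum_mu (R : realType) (V : choiceType) (G : weighted_graph R V)
    (x : V) (g : V -> R) :
  \sum_(y \in [set: V]) mu G x y * g y =
  \sum_(y <- fset_set [set y | edge G x y]) mu G x y * g y.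
Proof.
rewrite -fsbig_finite; last exact: edge_locally_finite.
apply/esym/fsbig_widen => // y [_ /= /negP xy].
by rewrite mu_eq0// mul0r.
Qed.

Lemma mu_ge0 (R : realType) (V : choiceType) (G : weighted_graph R V)
    (x y : V) : 0 <= mu G x y.
Proof.
by have [/mu_gt0/ltW|/mu_eq0->] := boolP (edge G x y).
Qed.

(** Squared increments are at most [c ^+ 2 * rho x y ^+ 2], so the intrinsic condition caps their
    weighted sum at [c ^+ 2 * m G x], and the prefactor of [Gamma] cancels [m G x]. *)
Lemma Gamma_lipschitz (R : realType) (V : choiceType) (G : weighted_graph R V)
    (rho : V -> V -> R) (c : R) (f : V -> R) (x : V) :
  intrinsic_metric G rho ->
  (forall y, `|f y - f x| <= c * rho x y) ->
  Gamma G f x <= c ^+ 2 / 2.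
Proof.
move=> [_ rho_m] f_lip; rewrite /Gamma invfM -mulrA.
rewrite [leRHS]mulrC ler_pM2l ?invr_gt0// mulrC ler_pdivrMr ?m_gt0//.
apply: le_trans (ler_wpM2l (sqr_ge0 c) (rho_m x)).
rewrite !fsum_mu mulr_sumr; apply: ler_sum => y _.
rewrite [leRHS]mulrCA -exprMn ler_wpM2l ?mu_ge0// -real_normK ?num_real//.
(* Squaring is monotone here: [c * rho x y] dominates an absolute value, hence is nonnegative. *)
by rewrite lerXn2r ?nnegrE// (le_trans _ (f_lip y)).
Qed.

Theorem theorem2p7 (R : realType) (V : choiceType) (G : weighted_graph R V)
    (rho : V -> V -> R) (o : V)
    (rho_intrinsic : intrinsic_metric G rho)
    (finite_balls : forall r : R, 0 < r -> finite_set [set x | rho x o <= r]) :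
  complete_graph G.
Proof.
have [[rho_ge0 rho_sym _ rho_tri] _] := rho_intrinsic.
(* The scale [n] is [k.+1], in step with the indexing from 0 and never zero. *)
exists (fun k x => clamp (2 - rho x o / k.+1%:R)); split.
- move=> k; apply: (sub_finite_set _ (finite_balls (2 * k.+1%:R) _)) => [x /=|].
    apply: contra_neqT; rewrite -ltNge => rho_gt.
    by rewrite clamp_eq0// subr_le0 ler_pdivlMr// ltW.
  by rewrite mulr_gt0.
- move=> x; apply/nondecreasing_seqP => k; apply: clamp_homo.
  by rewrite lerD2l lerN2 ler_wpM2l// lef_pV2 ?posrE// ler_nat.
(* The sequence is eventually constant: its value is 1 once [rho x o <= k]. *)
- move=> x; apply: cvg_near_cst; near=> k; apply: clamp_eq1.
  rewrite lerBrDl -lerBrDr (_ : 2 - 1 = 1) ?addrK//.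
  rewrite ler_pdivrMr// mul1r (@le_trans _ _ k%:R) ?ler_nat//.
  by near: k; exact: nbhs_infty_ger.
- move=> k x; apply: le_trans (_ : k.+1%:R^-1 ^+ 2 / 2 <= _).
    apply: Gamma_lipschitz rho_intrinsic _ => y.
    apply: le_trans (clamp_lipschitz _ _ _) _.
    rewrite opprB addrC subrKA -mulrBl normrM (@ger0_norm _ _^-1) ?invr_ge0// mulrC.
    (* What remains is the reverse triangle inequality for [rho]. *)
    rewrite ler_wpM2l// ler_norml.
    have := rho_tri x y o; have := rho_tri y x o; rewrite (rho_sym y x).
    by move=> *; lra.
  (* For [0 < a <= 1], [a ^+ 2 / 2 <= a]. *)
  have n0 : 0 < k.+1%:R^-1 :> R by rewrite invr_gt0.
  have n1 : k.+1%:R^-1 <= 1 :> R by rewrite invf_le1// ler1n.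
  by move: n0 n1; move: (k.+1%:R^-1) => a; nra.
Unshelve. all: by end_near. Qed.
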